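(* Let $A\in\mathbb{R}_{\min}^{n\times n}$ be an irreducible matrix. Let $\Gamma=(\gamma_1\leq\cdots\leq\gamma_n)$ be the sequence of roots of the min-plus characteristic polynomial of $A$ and let $\beta=(\beta_1\leq\cdots\leq\beta_n)$ be the sequence of critical values of $A$, repeated with multiplicities. Then $$\Gamma\prec^{\rm w}\beta .$$
   Context: The min-plus semiring $\mathbb{R}_{\min}$ is $\mathbb{R}\cup\{+\infty\}$ with addition $a\oplus b=\min(a,b)$ and multiplication $ab=a+b$ (zero element $+\infty$, unit $0$); matrix operations are taken in this sense. For a finite set $L$ and an $L\times L$ matrix $B$ over $\mathbb{R}_{\min}$, $G(B)$ is the digraph with node set $L$ and an arc $(i,j)$ whenever $B_{ij}\neq+\infty$; $B$ is irreducible if $G(B)$ is strongly connected. (When $n=1$, the matrix $(+\infty)$ is excluded, so that critical values are real.) For a path $p=(i_0,\ldots,i_k)$, $|p|_B=\sum_m B_{i_mi_{m+1}}$ and $|p|=k$. $\rho_{\min}(B)=\min_c|c|_B/|c|$ over circuits $c$ of $G(B)$ ($+\infty$ if there are none); a circuit is critical if it attains this minimum; its nodes are called critical nodes of $B$. Min-plus Schur complement: for $C\subset L$, $N=L\setminus C$ and $\lambda\in\mathbb{R}$ with $\lambda\leq\rho_{\min}(B_{CC})$, $\mathrm{Schur}(C,\lambda,B)=B_{NN}\oplus B_{NC}(\lambda^{-1}B_{CC})^*\lambda^{-1}B_{CN}$ (an $N\times N$ matrix), where $\lambda^{-1}M$ is $M$ with $\lambda$ subtracted from every entry and $M^*=I\oplus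 M\oplus M^2\oplus\cdots$ ($I$ the min-plus identity matrix). Critical values of an irreducible $A$: put $A_1=A$ and, for $\ell\geq1$, $\alpha_\ell=\rho_{\min}(A_\ell)$, $C_\ell$ the set of critical nodes of $A_\ell$, and, as long as $C_1\cup\cdots\cup C_\ell\neq\{1,\ldots,n\}$, $A_{\ell+1}=\mathrm{Schur}(C_\ell,\alpha_\ell,A_\ell)$. This stops at some $k\leq n$; $C_1,\ldots,C_k$ partition $\{1,\ldots,n\}$ and $\alpha_1<\cdots<\alpha_k$ are the critical values of $A$, $\alpha_\ell$ having multiplicity $\#C_\ell$. Repeating each with its multiplicity gives $\beta$. The min-plus characteristic polynomial of $A$ is $P=\bigoplus_{j=0}^nP_j\mathsf{Y}^j$ with $P_n=0$ and, for $1\le m\le n$, $P_{n-m}=\min_{\#J=m}\min_{\sigma\in\mathfrak{S}_J}\sum_{j\in J}A_{j\sigma(j)}$ ($J\subset\{1,\ldots,n\}$, $\mathfrak{S}_J$ the permutations of $J$). The roots of $P$ are the unique $\gamma_1\leq\cdots\leq\gamma_n$ in $\mathbb{R}\cup\{+\infty\}$ with $\min_k(P_k+ky)=P_n+\sum_i\min(y,\gamma_i)$ for all $y$. For $u,v\in\mathbb{R}_{\min}^n$ with increasingly ordered components $u_{(i)}$, $v_{(i)}$, $u\prec^{\rm w}v$ means $u_{(1)}+\cdots+u_{(m)}\geq v_{(1)}+\cdots+v_{(m)}$ for all $m=1,\ldots,n$. *)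

(* Defs.v *)
From HB Require Import structures.
From mathcomp Require Import all_boot all_order perm all_algebra.
From mathcomp Require Import all_classical all_reals ereal.

Set Implicit Arguments.
Unset Strict Implicit.
Unset Printing Implicit Defensive.

Import Order.TTheory GRing.Theory Num.Theory.

Local Open Scope ring_scope.
Local Open Scope ereal_scope.

(* The min-plus semiring R_min = R u {+oo} is the part of [\bar R] without    *)
(* [-oo]: its sum is [mine] (zero element +oo) and its product is [+] (unit   *)
(* 0).  An L x L matrix, L a finite set, is a function [L -> L -> \bar R].    *)

Section MinPlusMatrices.
Variable R : realType.

Definition mp_add (I J : finType) (B B' : I -> J -> \bar R) : I -> J -> \bar R :=
  fun i j => mine (B i j) (B' i j).

Definition mp_mul (I J K : finType) (B : I -> J -> \bar R)
    (B' : J -> K -> \bar R) : I -> K -> \bar R :=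
  fun i k => \big[mine/+oo]_(j : J) (B i j + B' j k).

Definition mp_id (I : finType) : I -> I -> \bar R :=
  fun i j => if i == j then 0 else +oo.

Definition mp_pow (I : finType) (B : I -> I -> \bar R) (k : nat) :
    I -> I -> \bar R :=
  iter k (mp_mul B) (@mp_id I).

(* Kleene star: the infinite min-plus sum of all powers. *)
Definition mp_star (I : finType) (B : I -> I -> \bar R) : I -> I -> \bar R :=
  fun i j => ereal_inf (range (fun k : nat => mp_pow B k i j)).

(* lambda^-1 B in the min-plus sense. *)
Definition mp_unscale (lambda : R) (I J : finType) (B : I -> J -> \bar R) :
    I -> J -> \bar R :=
  fun i j => B i j - lambda%:E.

Definition mp_block (L : finType) (B : L -> L -> \bar R) (X Y : {set L}) :
    {i : L | i \in X} -> {j : L | j \in Y} -> \bar R :=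
  fun i j => B (val i) (val j).
Global Arguments mp_block {L} B X Y.

Definition mp_schur (L : finType) (C : {set L}) (lambda : R)
    (B : L -> L -> \bar R) :
    {i : L | i \in ~: C} -> {i : L | i \in ~: C} -> \bar R :=
  mp_add (mp_block B (~: C) (~: C))
    (mp_mul
      (mp_mul (mp_block B (~: C) C) (mp_star (mp_unscale lambda (mp_block B C C))))
      (mp_unscale lambda (mp_block B C (~: C)))).
Global Arguments mp_schur {L} C lambda B.

End MinPlusMatrices.

Section Circuits.
Variables (R : realType) (L : finType) (B : L -> L -> \bar R).

Definition mp_arc : rel L := fun i j => B i j != +oo.

(* The second clause excludes the 1 x 1 matrix (+oo), whose digraph is        *)
(* strongly connected through the path of length 0.                           *)
Definition mp_irreducible : Prop :=
  (forall i j : L, connect mp_arc i j) /\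
  (#|L| = 1%N -> forall i : L, B i i != +oo).

(* The circuit (i_0, ..., i_(k-1), i_0), k >= 1, is encoded by the sequence   *)
(* [:: i_0; ...; i_(k-1)], in which nodes may be repeated.                    *)
Definition mp_circuit (c : seq L) : bool := (c != [::]) && cycle mp_arc c.

Definition mp_circuit_weight (c : seq L) : \bar R :=
  \sum_(a <- zip c (rot 1 c)) B a.1 a.2.

Definition mp_circuit_mean (c : seq L) : \bar R :=
  mp_circuit_weight c * ((size c)%:R^-1)%:E.

Definition mp_rho : \bar R :=
  ereal_inf [set mp_circuit_mean c | c in [set c | mp_circuit c]].

Definition mp_critical_circuit (c : seq L) : Prop :=
  mp_circuit c /\ mp_circuit_mean c = mp_rho.

Definition mp_critical_nodes : {set L} :=
  [set i | `[< exists c, mp_critical_circuit c /\ i \in c >]].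

End Circuits.

(* [fuel] bounds the number of steps; every step removes at least one node    *)
(* when [B] is irreducible, so that #|L| steps are enough.                    *)
Fixpoint mp_critical_values_rec (R : realType) (fuel : nat) (L : finType)
    (B : L -> L -> \bar R) : seq (\bar R) :=
  if fuel is fuel'.+1 then
    let alpha := mp_rho B in
    let C := mp_critical_nodes B in
    nseq #|C| alpha ++
      (if C == [set: L] then [::]
       else mp_critical_values_rec fuel' (mp_schur C (fine alpha) B))
  else [::].

Definition mp_critical_values (R : realType) (L : finType)
    (B : L -> L -> \bar R) : seq (\bar R) :=
  mp_critical_values_rec #|L| B.

(* The coefficient P_j of Y^j, for j <= n; see [mp_char_poly_lead] for j = n. *)
Definition mp_char_poly (R : realType) (n : nat) (A : 'I_n -> 'I_n -> \bar R)
    (j : nat) : \bar R :=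
  \big[mine/+oo]_(J : {set 'I_n} | #|J| == (n - j)%N)
    \big[mine/+oo]_(s : {perm 'I_n} | perm_on J s) \sum_(i in J) A i (s i).

Lemma mp_char_poly_lead (R : realType) (n : nat) (A : 'I_n -> 'I_n -> \bar R) :
  mp_char_poly A n = 0.
Proof.
rewrite /mp_char_poly subnn (big_pred1 (finset.set0 : {set 'I_n})); last first.
  by move=> J; rewrite cards_eq0.
rewrite (big_pred1 (perm_one 'I_n)) ?big_set0 // => s.
apply/idP/eqP => [s0|->]; last exact: perm_on1.
by apply/permP => i; rewrite perm1 (out_perm s0) ?inE.
Qed.

(* [gamma] is the increasing sequence of roots of the min-plus polynomial of  *)
(* degree n with coefficients P_0, ..., P_n.                                  *)
Definition mp_roots (R : realType) (n : nat) (P : nat -> \bar R)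
    (gamma : n.-tuple (\bar R)) : Prop :=
  [/\ sorted <=%O gamma,
      -oo \notin gamma &
      forall y : \bar R, y != -oo ->
        \big[mine/+oo]_(k < n.+1) (P k + y *+ k)
        = P n + \sum_(g <- gamma) mine y g].

Definition weak_majorized (R : realType) (u v : seq (\bar R)) : Prop :=
  size u = size v /\
  forall m : nat, (1 <= m <= size u)%N ->
    \sum_(x <- take m (sort <=%O v)) x <= \sum_(x <- take m (sort <=%O u)) x.

(* Main.v *)
Require Import Defs.
From mathcomp Require Import all_boot all_order all_algebra.
From mathcomp Require Import all_classical all_reals ereal.
From mathcomp Require Import perm ring lra zify.

(** The critical values are attached to the nodes: [b i] is the value
[alpha_l] of the class [C_l] that contains [i].  The heart of the proof is that
the sum of [b] along any circuit of [A] is at most the weight of the circuit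
([mp_critical_values_rec_dominates]).  This goes by induction along the
successive Schur complements.  A circuit inside [C_1] has mean at least
[alpha_1], by definition of [alpha_1].  Any other circuit visits a node outside
[C_1]; contracting its excursions into [C_1] gives a circuit of the Schur
complement, and since the Schur complement subtracts [alpha_1] once per node
of [C_1] on the detour, its weight is at most the original weight minus
[alpha_1] for every visit to [C_1] ([mp_schur_contract]).  The induction
hypothesis pays for the remaining nodes.

For the recursion to be meaningful, each complement must again have no [-oo]
entry and be strongly connected, and its minimal circuit mean must be a real
number attained by some circuit.  The first two facts follow from the
inequality on circuits and from the contraction; the third holds because a
circuit with a repeated node splits into two shorter ones, so only finitely
many circuits compete ([exists_critical_circuit]).

A permutation of [J] is a product of disjoint cycles, so its weight is at
least the sum of [b] over [J] ([sum_perm_dominates]).  Hence every term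
[P_k + k y] of the characteristic polynomial function is at least
[sum_i min(y, b i)], which gives
[sum_i min(y, gamma_i) >= sum_i min(y, beta_i)] for all real [y]
([sum_min_le_char_roots]).  At [y = beta_m] the right-hand side equals
[beta_1 + .. + beta_m + (n - m) y], while the left-hand side is at most
[gamma_1 + .. + gamma_m + (n - m) y]; cancelling the real number [(n - m) y]
yields the theorem. *)

Set Implicit Arguments.
Unset Strict Implicit.
Unset Printing Implicit Defensive.

Import Order.TTheory GRing.Theory Num.Theory.

Local Open Scope ring_scope.
Local Open Scope ereal_scope.

(** * Weights of paths and circuits *)

Section PathWeights.
Variables (R : realType) (L : finType).
Implicit Types (B : L -> L -> \bar R) (i j : L) (s t : seq L).

(** The starting node is kept apart from the list of the nodes visited next, so
that [path_weight B i (rcons s i)] is the weight of the circuit [i :: s]. *)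
Fixpoint path_weight B i s : \bar R :=
  if s is j :: s' then B i j + path_weight B j s' else 0.

(** All closed walks are quantified over, without asking that their arcs be in
the digraph: a missing arc makes the weight [+oo]. *)
Definition dominates_circuits (b : L -> R) B : Prop :=
  forall i s, (\sum_(k <- i :: s) b k)%:E <= path_weight B i (rcons s i).

Definition no_ninfty B : Prop := forall i j, B i j != -oo.

(** The joining path has at least one arc, even when [i = j]; this covers the
exclusion of the 1 x 1 matrix [+oo]. *)
Definition strongly_connected B : Prop :=
  forall i j, exists s, path_weight B i (rcons s j) < +oo.

Lemma path_weight_cat B i s t :
  path_weight B i (s ++ t) = path_weight B i s + path_weight B (last i s) t.
Proof.
by elim: s i => [|j s IH] i /=; rewrite ?add0e// IH addeA.
Qed.

Lemma path_weight_rcons_cat B i s j t :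
  path_weight B i (rcons s j ++ t) =
  path_weight B i (rcons s j) + path_weight B j t.
Proof. by rewrite path_weight_cat last_rcons. Qed.

Lemma path_weight_rcons_cons B i s j t k :
  path_weight B i (rcons (s ++ j :: t) k) =
  path_weight B i (rcons s j) + path_weight B j (rcons t k).
Proof. by rewrite -path_weight_rcons_cat rcons_cat /= cat_rcons. Qed.

Lemma path_weight_ninfty B i s : no_ninfty B -> path_weight B i s != -oo.
Proof.
move=> Bn; elim: s i => [|j s IH] i //=.
by rewrite adde_eq_ninfty negb_or Bn IH.
Qed.

Lemma path_weight_lty B i s : no_ninfty B ->
  (path_weight B i s < +oo) = path (mp_arc B) i s.
Proof.
move=> Bn; elim: s i => [|j s IH] i; first by rewrite /= ltry.
rewrite [RHS]/= -IH /= /mp_arc -ltey.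
have := Bn i j; have := path_weight_ninfty j s Bn.
by case: (B i j) (path_weight B j s) => [x||] [y||]//; rewrite ?ltry ?ltxx.
Qed.

Lemma circuit_weight_path B i s :
  mp_circuit_weight B (i :: s) = path_weight B i (rcons s i).
Proof.
rewrite /mp_circuit_weight rot1_cons.
elim: s {1 3}i => [|j s IH] k /=; rewrite big_cons /= ?big_nil//.
by rewrite IH.
Qed.

Lemma not_uniq_split s : ~~ uniq s ->
  exists s1 x s2 s3, s = s1 ++ x :: s2 ++ x :: s3.
Proof.
elim: s => //= x s IH; rewrite negb_and negbK.
have [/splitPr[s2 s3] _|_ /IH[s1 [y [s2 [s3 ->]]]]] := boolP (x \in s).
  by exists [::], x, s2, s3.
by exists (x :: s1), y, s2, s3.
Qed.

(** A circuit with a repeated node is the concatenation of two shorter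
circuits, and both sides of the inequality are additive. *)
Lemma dominates_circuits_short (b : L -> R) B :
  (forall i s, (size s <= #|L|)%N ->
     (\sum_(k <- i :: s) b k)%:E <= path_weight B i (rcons s i)) ->
  dominates_circuits b B.
Proof.
move=> short i s; have [m] := ubnP (size s).
elim: m i s => // m IH i s; rewrite ltnS => le_m.
have [us|] := boolP (uniq (i :: s)).
  by apply: short; rewrite ltnW// -[(size s).+1]/(size (i :: s)) -(card_uniqP us) max_card.
(* The first of the two occurrences is the base point, or comes after it. *)
move=> /not_uniq_split[[|k s1] [x [s2 [s3]]]] [? ?]; subst.
  rewrite path_weight_rcons_cons -cat_cons big_cat /= EFinD.
  by rewrite leeD//; apply: IH; move: le_m; rewrite size_cat /=; lia.
have -> : (\sum_(j <- k :: s1 ++ x :: s2 ++ x :: s3) b j =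
   \sum_(j <- k :: s1 ++ x :: s3) b j + \sum_(j <- x :: s2) b j)%R.
  by rewrite -!cat_cons !(big_cat, big_cons) /=; ring.
rewrite !path_weight_rcons_cons [X in _ <= _ + X]addeC addeA EFinD.
rewrite -path_weight_rcons_cons.
by rewrite leeD//; apply: IH; move: le_m; rewrite !size_cat /= ?size_cat /=; lia.
Qed.

Lemma EFin_sum_const (a : R) s :
  (\sum_(k <- s) a)%:E = a%:E * (size s)%:R%:E.
Proof. by rewrite big_const_seq count_predT iter_addr_0 -EFinM mulr_natr. Qed.

(** The minimum is taken over the finitely many circuits with a bounded number
of nodes; [dominates_circuits_short] makes it a minimum over all circuits.  It
is finite because some circuit has a finite weight. *)
Lemma exists_critical_circuit B (i0 : L) :
  no_ninfty B -> strongly_connected B ->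
  exists a i s, dominates_circuits (fun=> a) B /\
    path_weight B i (rcons s i) = (\sum_(k <- i :: s) a)%:E.
Proof.
move=> Bn Bc.
pose T := (L * {m : 'I_#|L|.+1 & m.-tuple L})%type.
pose mean i s : \bar R :=
  path_weight B i (rcons s i) * ((size s).+1%:R^-1)%:E.
pose F (t : T) : \bar R := mean t.1 (tagged t.2).
have t0 : T := (i0, Tagged (fun m : 'I_#|L|.+1 => m.-tuple L)
  (nseq_tuple (ord0 : 'I_#|L|.+1) i0)).
case: (@arg_minP _ _ _ t0 xpredT F isT) => -[i t] _ /= tmin.
have {}tmin j s : (size s <= #|L|)%N -> F (i, t) <= mean j s.
  move=> sL.
  exact: (tmin (j, Tagged (fun m : 'I_#|L|.+1 => m.-tuple L)
    (in_tuple s : (Ordinal (sL : (size s < #|L|.+1)%N)).-tuple L))).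
have posS m : (0 < m.+1%:R :> R)%R by rewrite ltr0n.
have Fn : F (i, t) != -oo.
  rewrite /F /mean /=; have := path_weight_ninfty i (rcons (tagged t) i) Bn.
  case: path_weight => [x||]//= _.
  by rewrite gt0_mulye// lte_fin invr_gt0.
case Fa : (F (i, t)) Fn => [a||] // _; last first.
  have [s] := Bc i0 i0; have := path_weight_ninfty i0 (rcons s i0) Bn.
  case wE : path_weight => [w||]// _ _.
  (* If no short circuit had a finite weight, every constant would bound the
     circuit means, in particular one larger than the weight [w]. *)
  have : dominates_circuits (fun=> `|w| + 1)%R B.
    apply: dominates_circuits_short => j u /(tmin j); rewrite Fa /mean.
    by rewrite lee_pdivlMr// gt0_mulye ?lte_fin// leye_eq => /eqP ->; rewrite leey.
  move=> /(_ i0 s); rewrite wE EFin_sum_const -EFinM lee_fin leNgt => /negP[].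
  rewrite (le_lt_trans (ler_norm w))// (@lt_le_trans _ _ (`|w| + 1)%R) ?ltrDl//.
  by rewrite ler_peMr ?addr_ge0// ler1n.
have dom : dominates_circuits (fun=> a) B.
  apply: dominates_circuits_short => j s /(tmin j); rewrite Fa /mean.
  by rewrite lee_pdivlMr// EFin_sum_const.
exists a, i, (tagged t); split => //.
move: Fa; rewrite /F /mean /= EFin_sum_const /=.
case: path_weight => [x||] //.
- by rewrite -!EFinM => -[<-]; rewrite divfK.
- by rewrite gt0_mulye// lte_fin invr_gt0.
- by rewrite gt0_mulNye// lte_fin invr_gt0.
Qed.

Lemma mp_rho_critical B a i s : no_ninfty B ->
  dominates_circuits (fun=> a) B ->
  path_weight B i (rcons s i) = (\sum_(k <- i :: s) a)%:E ->
  mp_rho B = a%:E /\ i \in mp_critical_nodes B.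
Proof.
move=> Bn dom crit.
have posS m : (0 < m.+1%:R :> R)%R by rewrite ltr0n.
have is_circ : mp_circuit B (i :: s).
  by rewrite /mp_circuit /= -path_weight_lty// crit ltry.
have mean_a : mp_circuit_mean B (i :: s) = a%:E.
  rewrite /mp_circuit_mean circuit_weight_path crit EFin_sum_const.
  by rewrite -!EFinM mulfK// gt_eqF.
have rho_a : mp_rho B = a%:E.
  apply/eqP; rewrite eq_le; apply/andP; split.
    by rewrite -mean_a; apply: ereal_inf_lbound; exists (i :: s).
  apply: le_ereal_inf_tmp => _ [[|j t] // _ <-].
  by rewrite /mp_circuit_mean lee_pdivlMr// circuit_weight_path -EFin_sum_const.
split=> //; rewrite inE; apply/asboolP; exists (i :: s).
by rewrite mem_head; split=> //; split=> //; rewrite mean_a rho_a.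
Qed.

Lemma strongly_connected_irreducible B :
  no_ninfty B -> mp_irreducible B -> strongly_connected B.
Proof.
move=> Bn [conn loop1] i j.
suff [s] : exists s, path (mp_arc B) i (rcons s j).
  by rewrite -path_weight_lty//; exists s.
have step k l : k != l -> exists s, path (mp_arc B) k (rcons s l).
  move=> kl; have /connectP[p] := conn k l.
  elim/last_ind: p => [_ /= lk|p x _ Bp]; first by rewrite lk eqxx in kl.
  by rewrite last_rcons => ->; exists p.
have [<-|] := eqVneq i j; last exact: step.
have [/existsP[k ki]|/existsPn L1] := boolP [exists k, k != i].
  have [p Bp] := step _ _ ki; have [q Bq] : exists q, path (mp_arc B) i (rcons q k).
    by apply: step; rewrite eq_sym.
  by exists (rcons q k ++ p); rewrite rcons_cat cat_path Bq last_rcons.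
exists [::]; rewrite /= andbT; apply: loop1.
by apply/eqP/fintype1P; exists i => k; apply/eqP; rewrite -[_ == _]negbK; exact: L1.
Qed.

Lemma mp_pow_le_path_weight B i s :
  mp_pow B (size s) i (last i s) <= path_weight B i s.
Proof.
elim: s i => [|j s IH] i; first by rewrite /mp_pow /= /mp_id eqxx.
by apply: le_trans (leeD2l _ (IH j)); exact: bigmin_le.
Qed.

Lemma mp_pow_attained B k i j : no_ninfty B -> mp_pow B k i j < +oo ->
  exists2 s, last i s = j & mp_pow B k i j = path_weight B i s.
Proof.
move=> Bn; rewrite ltey; elim: k i => [|k IH] i.
  by rewrite /mp_pow /= /mp_id; case: (eqVneq i j) => [-> _|]; [exists [::]|rewrite eqxx].
rewrite /mp_pow iterS -/(mp_pow B k) {1 2}/mp_mul.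
elim/big_ind: _ => // [x y Px Py|u _ fin].
  by rewrite minEle; case: ifP.
have Pu : mp_pow B k u j != +oo.
  by apply: contraNneq fin => ->; rewrite addey.
by have [s us ->] := IH _ Pu; exists (u :: s).
Qed.

End PathWeights.

(** * Contraction of paths in a Schur complement *)

Section SchurComplement.
Variables (R : realType) (L : finType) (B : L -> L -> \bar R).
Variables (C : {set L}) (a : R).
Hypotheses (Bn : no_ninfty B) (Bc : strongly_connected B).
Hypothesis dom : dominates_circuits (fun=> a) B.

Let N := {i : L | i \in ~: C}.
Let CC := mp_unscale a (mp_block B C C).
Let S := mp_schur C a B.

Lemma mp_unscale_path_weight x s :
  path_weight CC x s =
  path_weight B (val x) (map val s) - (\sum_(k <- s) a)%:E.
Proof.
elim: s x => [|y s IH] x; first by rewrite big_nil sube0.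
by rewrite /= IH big_cons opprD EFinD [RHS]addeACA.
Qed.

Lemma mp_unscale_ninfty : no_ninfty CC.
Proof. by move=> x y; rewrite /CC /mp_unscale adde_eq_ninfty negb_or Bn. Qed.

(** Closing a path from [x] to [y] by a fixed path of finite weight from [y]
to [x] gives a circuit, whose normalized weight is nonnegative: this bounds
from below all the terms of the infimum at once. *)
Lemma mp_star_ninfty x y : mp_star CC x y != -oo.
Proof.
have [s] := Bc (val y) (val x); have := path_weight_ninfty (val y) (rcons s (val x)) Bn.
case wE : path_weight => [w||]// _ _.
suff : (\sum_(k <- val x :: s) a - w)%:E <= mp_star CC x y.
  by rewrite -ltNye; apply: lt_le_trans; rewrite ltNyr.
apply: le_ereal_inf_tmp => _ [k _ <-].
have [/eqP|] := boolP (mp_pow CC k x y == +oo); first by move=> ->; rewrite leey.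
rewrite -ltey => /(mp_pow_attained mp_unscale_ninfty)[t xt ->].
rewrite mp_unscale_path_weight leeBrDr// EFinB -addeAC leeBlDr//.
have := dom (val x) (map val t ++ s); rewrite rcons_cat path_weight_cat.
rewrite last_map xt wE; apply: le_trans; rewrite -EFinD lee_fin.
by rewrite -cat_cons big_cat /= !big_cons big_map; lra.
Qed.

Lemma mp_mul_ninfty (I J K : finType) (M : I -> J -> \bar R) (M' : J -> K -> \bar R) i k :
  (forall i j, M i j != -oo) -> (forall j k, M' j k != -oo) ->
  mp_mul M M' i k != -oo.
Proof.
move=> Mn Mn'; rewrite /mp_mul; elim/big_ind: _ => // [x y xn yn|j _].
  by rewrite minEle; case: ifP.
by rewrite adde_eq_ninfty negb_or Mn Mn'.
Qed.

Lemma mp_schur_ninfty : no_ninfty S.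
Proof.
move=> i j; rewrite /S /mp_schur /mp_add minEle; case: ifP => _; first exact: Bn.
apply: mp_mul_ninfty => [{}i {}j|{}i {}j].
  by apply: mp_mul_ninfty => *; [exact: Bn|exact: mp_star_ninfty].
by rewrite adde_eq_ninfty negb_or Bn.
Qed.

Lemma lift_seq s : all [in C] s -> exists s' : seq {i | i \in C}, s = map val s'.
Proof.
elim: s => [_|x s IH /= /andP[xC /IH[s' ->]]]; first by exists [::].
by exists (exist _ x xC :: s').
Qed.

(** A single excursion into [C] is one of the paths over which an entry of the
Schur complement minimizes. *)
Lemma mp_schur_le_detour (i j : N) c : all [in C] c ->
  S i j + (\sum_(k <- c) a)%:E <= path_weight B (val i) (rcons c (val j)).
Proof.
case: c => [_|x c /= /andP[xC cC]].
  by rewrite big_nil /= !adde0 ge_min lexx.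
have [c' ->] := lift_seq cC; pose x' : {i | i \in C} := exist _ x xC.
set y := last x' c'.
have S_le : S i j <= B (val i) x + path_weight CC x' c' + (B (val y) (val j) - a%:E).
  rewrite /S /mp_schur /mp_add ge_min; apply/orP; right.
  apply: (le_trans (bigmin_le _ y _)); apply: leeD2r.
  apply: (le_trans (bigmin_le _ x' _)); apply: leeD2l.
  apply: le_trans (mp_pow_le_path_weight _ _ _).
  by apply: ereal_inf_lbound; exists (size c').
apply: le_trans (leeD2r _ S_le) _.
rewrite mp_unscale_path_weight /= -cats1 path_weight_cat.
rewrite -[X in last X _]/(val x') last_map -/y /= adde0.
rewrite big_cons big_map; set t := (\sum_(_ <- _) _)%R.
case: (B _ x) (path_weight B _ _) (B _ (val j)) => [p||] [q||] [r||] //=.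
by rewrite -!EFinD lee_fin; lra.
Qed.

(** Erasing the nodes of [C] from a path replaces each excursion into [C] by an
entry of the Schur complement.  The prefix [c] is the beginning of the excursion
in progress; it makes the induction on [s] go through. *)
Lemma mp_schur_contract (i j : N) c s : all [in C] c ->
  path_weight S i (rcons (pmap insub s) j) + (\sum_(k <- c ++ s | k \in C) a)%:E
  <= path_weight B (val i) (rcons (c ++ s) (val j)).
Proof.
have sumC d : all [in C] d ->
    (\sum_(k <- d | k \in C) a = \sum_(k <- d) a)%R.
  by move=> dC; rewrite -big_filter (all_filterP dC).
elim: s i c => [|x s IH] i c cC.
  by rewrite cats0 /= adde0 sumC// mp_schur_le_detour.
have [xC|xC] := boolP (x \in C).
  rewrite /= insubF ?inE ?xC//= -cat_rcons; apply: IH.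
  by rewrite all_rcons /= xC.
have xN : x \in ~: C by rewrite inE.
rewrite /= (insubT (mem (~: C)) xN) /= path_weight_rcons_cons.
rewrite big_cat big_cons (negPf xC) EFinD addeACA sumC//.
by rewrite leeD// ?(mp_schur_le_detour i (exist _ x xN))// (IH (exist _ x xN) [::]).
Qed.

Lemma mp_schur_strongly_connected : strongly_connected S.
Proof.
move=> i j; have [s Bs] := Bc (val i) (val j).
exists (pmap insub s).
have := le_lt_trans (@mp_schur_contract i j [::] s isT) Bs.
have := path_weight_ninfty i (rcons (pmap insub s) j) mp_schur_ninfty.
by case: path_weight => [x||] _ //=; rewrite ?ltry.
Qed.

Definition schur_extend (b : N -> R) (k : L) : R :=
  if insub k is Some k' then b k' else a.

Lemma sum_schur_extend b s :
  (\sum_(k <- s) schur_extend b k =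
   \sum_(k <- pmap insub s) b k + \sum_(k <- s | k \in C) a)%R.
Proof.
elim: s => [|x s IH]; first by rewrite !big_nil addr0.
rewrite !big_cons /= IH /schur_extend; case: insubP => [u|]; rewrite inE => xC.
  by move=> _ /=; rewrite big_cons (negPf xC) addrA.
by rewrite negbK in xC; rewrite xC /= addrCA.
Qed.

(** If a circuit leaves [C], it can be rotated to start outside [C] and then
contracted; otherwise the bound by the constant [a] applies. *)
Lemma dominates_circuits_schur b :
  dominates_circuits b S -> dominates_circuits (schur_extend b) B.
Proof.
move=> domS.
have startN (i : N) s : (\sum_(k <- val i :: s) schur_extend b k)%:E <=
    path_weight B (val i) (rcons s (val i)).
  apply: le_trans (@mp_schur_contract i i [::] s isT).
  apply: le_trans (leeD2r _ (domS i (pmap insub s))).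
  rewrite sum_schur_extend /= valK /= -EFinD lee_fin big_cons [X in (_ + X)%R]big_cons.
  by have := valP i; rewrite inE => /negPf ->.
move=> i s; have [sC|/allPn[x]] := boolP (all [in C] (i :: s)).
  rewrite (eq_big_seq (fun=> a)) ?dom// => k /(allP sC) /= kC.
  by rewrite /schur_extend insubF// inE kC.
move=> + xC; have xN : x \in ~: C by rewrite inE.
rewrite inE => /predU1P[<-|/splitPr[s1 s2]]; first exact: (startN (exist _ x xN) s).
rewrite path_weight_rcons_cons addeC -path_weight_rcons_cons.
have /(perm_big _) -> /= : perm_eq (i :: s1 ++ x :: s2) (x :: s2 ++ i :: s1).
  exact: (permEl (perm_catC (i :: s1) (x :: s2))).
exact: (startN (exist _ x xN) (s2 ++ i :: s1)).
Qed.

Lemma perm_schur_extend b :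
  perm_eq [seq (schur_extend b k)%:E | k <- enum L]
          (nseq #|C| a%:E ++ [seq (b k)%:E | k <- enum {: N}]).
Proof.
have split_enum : perm_eq (enum L) (enum C ++ [seq val k | k <- enum {: N}]).
  apply: uniq_perm => [||k]; first exact: enum_uniq.
    rewrite cat_uniq enum_uniq (map_inj_uniq val_inj) enum_uniq andbT /=.
    apply/hasPn => _ /mapP[k _ ->] /=; rewrite mem_enum.
    by have := valP k; rewrite inE.
  rewrite mem_cat !mem_enum; apply/esym; have [//|kC /=] := boolP (k \in C).
  have kN : k \in ~: C by rewrite inE.
  by apply/mapP; exists (exist _ k kN); rewrite ?mem_enum.
rewrite (perm_trans (perm_map _ split_enum))// map_cat -map_comp.
have -> : [seq (schur_extend b k)%:E | k <- enum C] = nseq #|C| a%:E.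
  rewrite cardE -(size_map (fun k => (schur_extend b k)%:E)); apply/all_pred1P.
  apply/allP => _ /mapP[k + ->]; rewrite mem_enum /schur_extend => kC /=.
  by rewrite insubF// inE kC.
set u := nseq _ _ ++ _; set v := nseq _ _ ++ _.
suff -> : u = v by [].
by congr (_ ++ _); apply: eq_map => k /=; rewrite /schur_extend valK.
Qed.

End SchurComplement.

(** * Critical values bound circuits and permutations *)

Section CriticalValues.
Variable R : realType.

(** The function [b] sends a node to the critical value of its class.  The
fuel suffices because a critical circuit exists, so that each step removes at
least one node. *)
Lemma mp_critical_values_rec_dominates fuel (L : finType) (B : L -> L -> \bar R) :
  (#|L| <= fuel)%N -> no_ninfty B -> strongly_connected B ->
  exists b : L -> R,
    perm_eq (mp_critical_values_rec fuel B) [seq (b k)%:E | k <- enum L] /\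
    dominates_circuits b B.
Proof.
elim: fuel L B => [|fuel IH] L B L_fuel Bn Bc.
  exists (fun=> 0%R); split; last by move=> i; have := fintype0 i; move: L_fuel; case: #|L|.
  by move: L_fuel; rewrite cardE /=; case: (enum L).
have [i0 _|L0] := pickP (@predT L); last first.
  have /eqP LE : #|L| == 0%N by apply/eqP/eq_card0.
  exists (fun=> 0%R); split; last by move=> i; have := L0 i.
  have EL : enum L = [::] by apply: size0nil; rewrite -cardE.
  rewrite /=; have -> : mp_critical_nodes B = [set: L].
    by apply/setP => i; have := L0 i.
  by rewrite EL eqxx cardsT LE.
have [a [i [s [dom crit]]]] := exists_critical_circuit i0 Bn Bc.
have [rho_a iC] := mp_rho_critical Bn dom crit.
rewrite /= rho_a /=; set C := mp_critical_nodes B in iC *.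
pose N := {k : L | k \in ~: C}.
have cardN : (#|C| + #|{: N}|)%N = #|L| by rewrite card_sig -(cardsC C).
have C_gt0 : (0 < #|C|)%N by apply/card_gt0P; exists i.
(* When [C] is everything the complement is indexed by an empty type, and any
   [b] on it serves; so the two branches extend in the same way. *)
suff [b [rest dom_b]] : exists b : N -> R,
    perm_eq (if C == [set: L] then [::]
             else mp_critical_values_rec fuel (mp_schur C a B))
            [seq (b k)%:E | k <- enum {: N}] /\
    dominates_circuits b (mp_schur C a B).
  exists (schur_extend a b); split; last exact: dominates_circuits_schur.
  rewrite perm_sym (perm_trans (perm_schur_extend a b))//.
  by rewrite perm_cat2l perm_sym.
case: ifP => [/eqP CT|_]; last first.
  apply: IH; [|exact: mp_schur_ninfty|].
    rewrite -ltnS (leq_trans _ L_fuel)// -cardN -[X in (X < _)%N]add0n.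
    by rewrite ltn_add2r.
  exact: mp_schur_strongly_connected.
have N0 (k : N) : False by case: k => k; rewrite CT !inE.
exists (fun=> a); split=> [|k]; last by case: (N0 k).
by case: (enum {: N}) => [//|k]; case: (N0 k).
Qed.

(** Peel off the orbits of [s] one at a time: each is a circuit. *)
Lemma sum_perm_dominates (L : finType) (B : L -> L -> \bar R) b
    (J : {set L}) (s : {perm L}) :
  dominates_circuits b B -> perm_on J s ->
  (\sum_(i in J) b i)%:E <= \sum_(i in J) B i (s i).
Proof.
move=> dom sJ.
have {sJ} : {in J, forall i, s i \in J} by move=> i iJ; rewrite perm_closed.
have [m] := ubnP #|J|; elim: m J => // m IH J; rewrite ltnS => leJ sJ.
have [->|[i iJ]] := set_0Vmem J; first by rewrite !big_set0.
pose O := porbit s i.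
have OJ : O \subset J.
  apply/fintype.subsetP => k /porbitP[q ->]; rewrite permX.
  by elim: q => //= q; exact: sJ.
have iO : i \in O by exact: porbit_id.
rewrite (big_setID O) [X in _ <= X](big_setID O) /= (finset.setIidPr OJ) EFinD leeD//; last first.
  apply: IH => [|k].
    rewrite cardsD (finset.setIidPr OJ) (leq_trans _ leJ)// ltn_subrL.
    by rewrite !card_gt0; apply/andP; split; apply/set0Pn; exists i.
  rewrite !inE => /andP[kO kJ]; rewrite sJ// andbT; apply: contraNN kO.
  by rewrite /O -!eq_porbit_mem -(porbit_perm s 1 k) expg1.
pose t := traject s i #|O|.
have sumO (V : nmodType) (f : L -> V) : (\sum_(k in O) f k = \sum_(k <- t) f k)%R.
  rewrite big_uniq ?uniq_traject_porbit//=.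
  by apply: eq_bigl => k; rewrite porbit_traject.
rewrite !sumO.
have weight q j : path_weight B j (traject s (s j) q) = \sum_(k <- traject s j q) B k (s k).
  by elim: q j => [|q IHq] j /=; rewrite ?big_nil// big_cons IHq.
have O_gt0 : (0 < #|O|)%N by rewrite card_gt0; apply/set0Pn; exists i.
rewrite -weight; have := iter_porbit s i; rewrite -/O.
rewrite /t -(prednK O_gt0) iterSr [traject s (s i) _]trajectSr => ->.
exact: dom.
Qed.

End CriticalValues.

(** * Roots of the characteristic polynomial *)

Section CharacteristicPolynomial.
Variables (R : realType) (n : nat).

(** In each term of the polynomial function, the [n - k] nodes of [J] are paid
for by the permutation and the [k] other ones by [k y]. *)
Lemma sum_min_le_char_roots (A : 'I_n -> 'I_n -> \bar R) b
    (gamma : n.-tuple (\bar R)) (y : R) :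
  dominates_circuits b A -> mp_roots (mp_char_poly A) gamma ->
  (\sum_(i < n) Num.min y (b i))%:E <= \sum_(g <- gamma) mine y%:E g.
Proof.
move=> dom [_ _ /(_ y%:E isT)]; rewrite mp_char_poly_lead add0e => <-.
apply: le_bigmin => [|k _]; first exact: leey.
rewrite -EFin_natmul -leeBlDr// /mp_char_poly.
apply: le_bigmin => [|J /eqP cardJ]; first exact: leey.
apply: le_bigmin => [|s sJ]; first exact: leey.
apply: le_trans (sum_perm_dominates dom sJ); rewrite lee_fin lerBlDr.
have -> : (y *+ k = \sum_(i in ~: J) y)%R.
  rewrite sumr_const; congr (_ *+ _)%R.
  have := cardsC J; rewrite cardJ card_ord => /(canRL (addKn _)) ->.
  by rewrite subKn// -ltnS.
rewrite (bigID (mem J)) /= lerD ?ler_sum//.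
  by move=> i _; rewrite ge_min lexx orbT.
rewrite [leLHS](eq_bigl [in ~: J]) => [|i]; last by rewrite inE.
by apply: ler_sum => i _; rewrite ge_min lexx.
Qed.

End CharacteristicPolynomial.

(** Truncating at the [m]-th smallest entry keeps the [m] smallest ones; this
is why the inequality between truncated sums is used at that level. *)
Lemma sum_min_sorted (R : realType) (t : seq R) m :
  sorted <=%R t -> (0 < m <= size t)%N ->
  (\sum_(x <- t) Num.min (nth 0 t m.-1) x =
   \sum_(x <- take m t) x + nth 0 t m.-1 *+ (size t - m))%R.
Proof.
move=> t_sorted /andP[m0 mt]; set y := nth _ _ _.
have m_pred_lt : (m.-1 < size t)%N by rewrite prednK.
have nth_le := sorted_leq_nth le_trans lexx 0%R t_sorted.
rewrite -{1}(cat_take_drop m t) big_cat; congr (_ + _)%R.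
  apply: eq_big_seq => x /(nthP 0%R)[i]; rewrite size_takel// => im <-.
  rewrite nth_take//; apply: min_r; apply: nth_le; rewrite ?inE//.
    exact: leq_trans im mt.
  by rewrite -ltnS prednK.
rewrite (eq_big_seq (fun=> y)) => [|x /(nthP 0%R)[i]].
  by rewrite big_const_seq count_predT iter_addr_0 size_drop.
rewrite size_drop => im <-; rewrite nth_drop; apply: min_l.
apply: nth_le; rewrite ?inE -?ltn_subRL//.
by rewrite (leq_trans (leq_pred m))// leq_addr.
Qed.

Lemma sum_min_take (R : realType) (y : R) (s : seq (\bar R)) m :
  (m <= size s)%N ->
  \sum_(x <- s) mine y%:E x <=
  \sum_(x <- take m s) x + (y *+ (size s - m))%:E.
Proof.
move=> ms; rewrite -{1}(cat_take_drop m s) big_cat leeD//.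
  by apply: lee_sum => x _; rewrite ge_min lexx orbT.
rewrite -size_drop; elim: drop => [|x u IH]; first by rewrite big_nil.
by rewrite big_cons mulrS EFinD leeD// ge_min lexx.
Qed.

Theorem theorem4p6 (R : realType) (n : nat) (A : 'M[\bar R]_n)
    (A_Rmin : forall i j : 'I_n, A i j != -oo)
    (A_irr : mp_irreducible A)
    (gamma : n.-tuple (\bar R))
    (gamma_roots : mp_roots (mp_char_poly A) gamma) :
  weak_majorized gamma (mp_critical_values A).
Proof.
have [b [perm_b dom]] := mp_critical_values_rec_dominates (leqnn #|'I_n|) A_Rmin
  (strongly_connected_irreducible A_Rmin A_irr).
rewrite -/(mp_critical_values A) in perm_b.
pose t := sort <=%R [seq b k | k <- enum 'I_n].
have size_t : size t = n by rewrite size_sort size_map -cardE card_ord.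
have sort_values : sort <=%O (mp_critical_values A) = [seq x%:E | x <- t].
  apply: le_sorted_eq; first exact/sort_sorted/le_total.
    rewrite sorted_map; exact/sort_sorted/le_total.
  by rewrite perm_sort (perm_trans perm_b)// map_comp perm_map// perm_sym perm_sort.
have size_values : size (mp_critical_values A) = n.
  by rewrite -(size_sort <=%O) sort_values size_map.
split=> [|m]; first by rewrite size_tuple size_values.
rewrite size_tuple => /andP[m0 mn].
rewrite sort_values (sorted_sort le_trans (let: And3 s _ _ := gamma_roots in s)).
have m_t : (0 < m <= size t)%N by rewrite size_t m0.
have := sum_min_le_char_roots (nth 0%R t m.-1) dom gamma_roots.
have -> : (\sum_(i < n) Num.min (nth 0 t m.-1) (b i) =
    \sum_(x <- t) Num.min (nth 0 t m.-1) x)%R.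
  by rewrite [RHS](perm_big [seq b k | k <- enum 'I_n]) ?perm_sort//= big_map big_enum.
rewrite sum_min_sorted//; last exact/sort_sorted/le_total.
have mg : (m <= size gamma)%N by rewrite size_tuple.
move=> /le_trans/(_ (sum_min_take _ mg)); rewrite EFinD size_t size_tuple.
by rewrite leeD2rE// -map_take big_map sumEFin.
Qed.
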